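(* Let $\mathbb A$ be $\mathbb R$ or $\mathbb C$, and let $\mathbb P^n$ be the projective $n$-space over $\mathbb A$. Consider a subvariety $V \subset \mathbb P^n$ given by one or several (nonzero) homogeneous polynomial equations of degrees $\leq d$. (1) If $V$ contains all the nodes from a supra-simplicial set $\mathsf A$ of a $d^{\{n\}}$-cage $\mathsf K \subset \mathbb P^n$, then $V$ contains all $d^n$ nodes of $\mathsf K$. Moreover, any such variety $V$ is given by polynomial equations of the form $\{\mathcal P_{\mathsf K, \vec\lambda} = 0\}_{\vec\lambda}$ for an appropriate choice of (one or several) nonzero vectors $\vec\lambda \in \mathbb A^n$. (2) In contrast, no subvariety $V \subset \mathbb P^n$ given by one or several (nonzero) homogeneous polynomial equations of degrees $\leq d$ contains all the nodes from a simplicial set $\tilde{\mathsf T}$ of any $(d+1)^{\{n\}}$-cage $\tilde{\mathsf K} \subset \mathbb P^n$.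
   Context: ''Variety'' means algebraic set (a common zero set of polynomials; no irreducibility is required). Cage: a $d^{\{n\}}$-cage $\mathsf K$ in $\mathbb P^n$ is a configuration of $n$ distinctly colored groups of hyperplanes, each group consisting of $d$ hyperplanes, such that $\mathsf K$ generates exactly $d^n$ points where hyperplanes of all $n$ distinct colors intersect transversally. (Thus any $n$ hyperplanes of pairwise distinct colors are in general position and meet in one point, and the $d^n$ points so obtained are distinct.) These $d^n$ points are the nodes of $\mathsf K$. Indexing: after ordering the hyperplanes $H_{j,1},\dots,H_{j,d}$ within each color $j\in\{1,\dots,n\}$, each node is labeled $p_I$ by a unique multi-index $I=(i_1,\dots,i_n)$ with $1\le i_j\le d$, where $p_I = \bigcap_{j} H_{j,i_j}$. Put $\|I\| = i_1+\dots+i_n$. A set of nodes of a $d^{\{n\}}$-cage is simplicial if, for some orderings of the hyperplanes in each group, it equals $\{p_I : \|I\|\le d+n-1\}$. It is supra-simplicial if, for some orderings, it equals $\{p_I : \|I\|\le d+n\}$ (always with $1\le i_j\le d$). For a $(d+1)^{\{n\}}$-cage, $d$ is replaced by $d+1$ throughout. Polynomials: fix homogeneous linear forms $L_{j,i}$ on $\mathbb A^{n+1}$ with $H_{j,i}=\{L_{j,i}=0\}$, put $\mathcal L_j=\prod_{i=1}^d L_{j,i}$, and for a nonzero vector $\vec\lambda=(\lambda_1,\dots,\lambda_n)\in\mathbb A^n$ put $\mathcal P_{\mathsf K,\vec\lambda}=\sum_{j=1}^n \lambda_j\,\mathcal L_j$. *)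

(* Defs.v *)
From HB Require Import structures.
From mathcomp Require Import all_boot all_order all_fingroup all_algebra.
From mathcomp Require Import classical_sets reals.
From mathcomp Require Import complex.
From mathcomp Require Import mpoly.

Set Implicit Arguments.
Unset Strict Implicit.
Unset Printing Implicit Defensive.

Import GRing.Theory.
Local Open Scope ring_scope.
Local Open Scope classical_set_scope.

(* The space P^n: points are the lines through the origin of A^(n+1). *)
Definition proj (A : fieldType) (n : nat) : Type :=
  {U : {vspace 'rV[A]_n.+1} | \dim U == 1%N}.

Definition peval (A : fieldType) (n : nat) (f : {mpoly A[n.+1]})
    (v : 'rV[A]_n.+1) : A :=
  f.@[fun k => v 0 k].

(* For homogeneous f, vanishing on the whole line is the same as vanishing at
   one nonzero vector of it. *)
Definition vanishes_at (A : fieldType) (n : nat) (f : {mpoly A[n.+1]})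
    (x : proj A n) : Prop :=
  forall v : 'rV[A]_n.+1, v \in sval x -> peval f v = 0.

Definition zero_locus (A : fieldType) (n : nat) (fs : seq {mpoly A[n.+1]}) :
    set (proj A n) :=
  [set x | forall f, f \in fs -> vanishes_at f x].

(* V is cut out by one or several nonzero homogeneous equations of degrees
   at most d (0 belongs to k.-homog, hence the explicit f != 0). *)
Definition given_in_degrees_le (A : fieldType) (n d : nat)
    (V : set (proj A n)) : Prop :=
  exists fs : seq {mpoly A[n.+1]},
    [/\ fs != [::],
        forall f, f \in fs ->
          f != 0 /\ exists2 k : nat, (k <= d)%N & f \is k.-homog
      & V = zero_locus fs].

(* A hyperplane of P^n is a subspace of dimension n of A^(n+1).  The n
   hyperplanes of distinct colors are transversal exactly when their
   codimensions add up, i.e. when they intersect in a line of A^(n+1). The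
   injectivity condition says that the d ^ n nodes are distinct, which
   also makes the d hyperplanes of each color distinct. *)
Record cage (A : fieldType) (n d : nat) := Cage {
  hyp : 'I_n -> 'I_d -> {vspace 'rV[A]_n.+1};
  hyp_dim : forall j i, \dim (hyp j i) = n;
  cage_transversal : forall I : {ffun 'I_n -> 'I_d},
    \dim (\bigcap_(j < n) hyp j (I j))%VS == 1%N;
  cage_distinct : injective (fun I : {ffun 'I_n -> 'I_d} =>
    (\bigcap_(j < n) hyp j (I j))%VS)
}.

Definition node (A : fieldType) (n d : nat) (K : cage A n d)
    (I : {ffun 'I_n -> 'I_d}) : proj A n :=
  exist _ (\bigcap_(j < n) hyp K j (I j))%VS (cage_transversal K I).

(* Elements of 'I_d start at 0, the multi-indices of the nodes at 1. *)
Definition mnorm (n d : nat) (I : {ffun 'I_n -> 'I_d}) : nat :=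
  (\sum_(j < n) (I j).+1)%N.

(* The nodes p_I with ||I|| <= m, once the hyperplanes of each color j have
   been reordered along s j. *)
Definition nodes_upto (A : fieldType) (n d : nat) (K : cage A n d)
    (s : 'I_n -> 'S_d) (m : nat) : set (proj A n) :=
  [set node K [ffun j => s j (I j)] | I in [set I | (mnorm I <= m)%N]].

Definition simplicial (A : fieldType) (n d : nat) (K : cage A n d)
    (S : set (proj A n)) : Prop :=
  exists s : 'I_n -> 'S_d, S = nodes_upto K s (d + n - 1)%N.

Definition supra_simplicial (A : fieldType) (n d : nat) (K : cage A n d)
    (S : set (proj A n)) : Prop :=
  exists s : 'I_n -> 'S_d, S = nodes_upto K s (d + n)%N.

Definition defining_forms (A : fieldType) (n d : nat) (K : cage A n d)
    (L : 'I_n -> 'I_d -> {mpoly A[n.+1]}) : Prop :=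
  forall j i, L j i \is 1.-homog /\
    forall v, v \in hyp K j i <-> peval (L j i) v = 0.

Definition cage_poly (A : fieldType) (n d : nat)
    (L : 'I_n -> 'I_d -> {mpoly A[n.+1]}) (lam : 'rV[A]_n) : {mpoly A[n.+1]} :=
  \sum_(j < n) lam 0 j *: \prod_(i < d) L j i.

(* Main.v *)
(* Newton interpolation on the cage. To a monomial x of degree k <= d in the
   variables X_0, ..., X_n, with exponents m_j for j = 1, ..., n, attach
     Q_x = X_c^(m_0) * \prod_j \prod_(i < m_j) L_{j,i}
   and the node p_x with (0-based) multi-index (m_1, ..., m_n); X_c is a
   coordinate not vanishing at p_x. If some m_j = d there is no such node, and
   p_x is a generic point of the line cut out by the first hyperplanes of the
   other colors. Then Q_x(p_y) != 0 forces m(x) <= m(y) componentwise, so the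
   evaluation matrix is triangular and the Q_x, being as many as the monomials,
   form a basis of the forms of degree k. A form of degree k vanishing at the
   nodes p_x with all m_j < d has only the coefficients of Q_x with some
   m_j = d. If k < d there are none, so the form is 0; if k = d they are the
   products \prod_(i < d) L_{j,i}, which vanish at all the nodes. *)

Require Import Defs.
From HB Require Import structures.
From mathcomp Require Import all_boot all_order all_fingroup all_algebra.
From mathcomp Require Import classical_sets reals.
From mathcomp Require Import complex.
From mathcomp Require Import mpoly.
From mathcomp Require Import zify.

Set Implicit Arguments.
Unset Strict Implicit.
Unset Printing Implicit Defensive.

Import GRing.Theory.
Local Open Scope ring_scope.
Local Open Scope classical_set_scope.

(** * Triangular systems over a field *)

(** Strong induction on [r j]: any other nonzero entry of column [j] lies in a row of smaller rank,
    again in [D], whose coefficient is already zero. Thus the equations indexed by [D] alone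
    determine the coefficients on [D]. *)
Lemma triangular_eq0 (F : fieldType) (T : finType) (E : T -> T -> F)
    (r : T -> nat) (D : pred T) (c : T -> F) :
  (forall i, E i i != 0) ->
  (forall i j, i != j -> E i j != 0 -> (r i < r j)%N) ->
  (forall i j, D j -> E i j != 0 -> D i) ->
  (forall j, D j -> \sum_i c i * E i j = 0) ->
  forall j, D j -> c j = 0.
Proof.
move=> E1 Er ED cE j; have [b] := ubnP (r j); elim: b j => // b IH j rj Dj.
have := cE j Dj; rewrite (bigD1 j) //= big1 ?addr0.
  by move/eqP; rewrite mulf_eq0 (negPf (E1 j)) orbF => /eqP.
move=> i ij; have [->|Eij] := eqVneq (E i j) 0; first by rewrite mulr0.
rewrite IH ?mul0r //; last exact: ED Eij.
exact: leq_trans (Er _ _ ij Eij) _.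
Qed.

(* The square matrix C is invertible because C *m V is triangular. *)
Lemma triangular_span (F : fieldType) (T : finType) (C V : T -> T -> F)
    (r : T -> nat) (a : T -> F) :
  (forall i, \sum_l C i l * V l i != 0) ->
  (forall i j, i != j -> \sum_l C i l * V l j != 0 -> (r i < r j)%N) ->
  exists c : T -> F, forall l, a l = \sum_i c i * C i l.
Proof.
move=> E1 Er.
have ev (G : T -> F) : \sum_i G i = \sum_(i < #|T|) G (enum_val i).
  by rewrite -(big_enum_val (A := T) G).
pose CM := \matrix_(i < #|T|, l < #|T|) C (enum_val i) (enum_val l).
pose VM := \matrix_(l < #|T|, j < #|T|) V (enum_val l) (enum_val j).
have free : row_free (CM *m VM).
  apply/row_freeP; apply/row_freeP/inj_row_free => u u0.
  apply/rowP => i; rewrite mxE.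
  suff : forall x : T, u 0 (enum_rank x) = 0.
    by move/(_ (enum_val i)); rewrite enum_valK.
  move=> x; apply: (triangular_eq0 (c := fun x => u 0 (enum_rank x))
    (D := predT) E1 Er) => // j _.
  move/rowP/(_ (enum_rank j)): u0; rewrite !mxE => u0j; rewrite -[RHS]u0j ev.
  apply: eq_bigr => k _; rewrite enum_valK !mxE ev; congr (_ * _).
  by apply: eq_bigr => l _; rewrite !mxE enum_rankK.
have CU : CM \in unitmx.
  by move: free; rewrite row_free_unit unitmx_mul => /andP[].
pose am := \row_(l < #|T|) a (enum_val l).
exists (fun x => (am *m invmx CM) 0 (enum_rank x)) => l.
have /rowP/(_ (enum_rank l)) := mulmxKV CU am.
rewrite mxE [RHS]mxE enum_rankK ev => <-; apply: eq_bigr => i _.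
by rewrite enum_valK [CM _ _]mxE enum_rankK.
Qed.

(** * Homogeneous polynomials and their expansion in a Newton basis *)

(** The degree bound [k.+1] makes the type finite, so that it can index sums and square matrices. *)
Definition monomials (n k : nat) : finType :=
  {m : 'X_{1..n.+1 < k.+1} | mdeg m == k}.

Definition monomial (n k : nat) (x : monomials n k) : 'X_{1..n.+1} :=
  val (val x).

Lemma monomial_deg (n k : nat) (x : monomials n k) : mdeg (monomial x) = k.
Proof. exact/eqP/(valP x). Qed.

Lemma monomial_inj (n k : nat) : injective (@monomial n k).
Proof. by move=> x y xy; do 2!apply: val_inj. Qed.

Lemma monomialP (n k : nat) (m : 'X_{1..n.+1}) :
  mdeg m = k -> exists x : monomials n k, monomial x = m.
Proof.
move=> mk; have mlt : (mdeg m < k.+1)%N by rewrite mk.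
have me : mdeg (BMultinom mlt) == k by apply/eqP.
by exists (exist _ (BMultinom mlt) me).
Qed.

Lemma homog_monomials (F : fieldType) (n k : nat) (f : {mpoly F[n.+1]}) :
  f \is k.-homog ->
  f = \sum_(x : monomials n k) f@_(monomial x) *: 'X_[monomial x].
Proof.
move=> fk; apply/mpolyP => m; rewrite raddf_sum /=.
have [mk|/eqP mk] := eqVneq (mdeg m) k.
  have [x <-] := monomialP mk; rewrite (bigD1 x) //= big1 ?addr0.
    by rewrite mcoeffZ mcoeffX eqxx mulr1.
  move=> y yx; rewrite mcoeffZ mcoeffX (inj_eq (@monomial_inj _ _)).
  by rewrite (negPf yx) mulr0.
rewrite (dhomog_nemf_coeff fk) ?big1 //; last exact/eqP.
move=> y _; rewrite mcoeffZ mcoeffX; case: eqP => [ym|]; last by rewrite mulr0.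
by case: mk; rewrite -ym monomial_deg.
Qed.

(** There are as many [Q x] as monomials of degree [k], so triangularity of their values at the
    points makes them a basis. [D] marks the points where [f] is known to vanish. *)
Lemma newton_expansion (F : fieldType) (n k : nat)
    (Q : monomials n k -> {mpoly F[n.+1]}) (p : monomials n k -> 'rV[F]_n.+1)
    (r : monomials n k -> nat) (D : pred (monomials n k))
    (f : {mpoly F[n.+1]}) :
  (forall x, Q x \is k.-homog) ->
  (forall x, peval (Q x) (p x) != 0) ->
  (forall x y, x != y -> peval (Q x) (p y) != 0 -> (r x < r y)%N) ->
  (forall x y, D y -> peval (Q x) (p y) != 0 -> D x) ->
  f \is k.-homog -> (forall x, D x -> peval f (p x) = 0) ->
  exists c, f = \sum_(x | ~~ D x) c x *: Q x.
Proof.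
move=> Qk Q1 Qr QD fk f0.
(* The evaluation matrix factors as coefficients of the [Q x] times values of the monomials; this is
   the product that [triangular_span] needs. *)
have QE x y : peval (Q x) (p y) =
    \sum_(z : monomials n k) (Q x)@_(monomial z) * peval 'X_[monomial z] (p y).
  rewrite {1}(homog_monomials (Qk x)) /peval raddf_sum /=.
   by apply: eq_bigr => z _; rewrite mevalZ.
have [||c fc] := @triangular_span F _ (fun x z => (Q x)@_(monomial z))
  (fun z y => peval 'X_[monomial z] (p y)) r (fun z => f@_(monomial z)).
- by move=> x; rewrite -QE.
- by move=> x y xy; rewrite -QE; apply: Qr.
have fE : f = \sum_x c x *: Q x.
  rewrite [LHS](homog_monomials fk).
  rewrite [RHS](homog_monomials (k := k)); last first.
    by apply: rpred_sum => x _; apply: rpredZ; apply: Qk.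
  apply: eq_bigr => z _; rewrite fc raddf_sum /=; congr (_ *: _).
  by apply: eq_bigr => x _; rewrite mcoeffZ.
exists c; rewrite [LHS]fE (bigID D) /= big1 ?add0r // => x Dx.
rewrite (triangular_eq0 Q1 Qr QD _ Dx) ?scale0r // => y Dy.
rewrite -[RHS](f0 y Dy) fE /peval raddf_sum /=.
by apply: eq_bigr => z _; rewrite mevalZ.
Qed.

(** * Linear forms and hyperplanes *)

Lemma homog_bigprod (F : fieldType) (n : nat) (I : finType) (P : pred I)
    (e : I -> nat) (G : I -> {mpoly F[n]}) :
  (forall i, P i -> G i \is (e i).-homog) ->
  \prod_(i | P i) G i \is (\sum_(i | P i) e i).-homog.
Proof.
move=> GP; apply: (big_rec2 (fun (g : {mpoly F[n]}) k => g \is k.-homog)).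
  exact: dhomog1.
by move=> i g k Pi gk; apply: dhomogM; [apply: GP|].
Qed.

Lemma homog1_linear (F : fieldType) (n : nat) (l : {mpoly F[n.+1]})
    (t : F) (v w : 'rV[F]_n.+1) :
  l \is 1.-homog -> peval l (v + t *: w) = peval l v + t * peval l w.
Proof.
move=> l1; rewrite /peval !mevalE mulr_sumr -big_split /=.
rewrite !big_seq; apply: eq_bigr => m ml.
have /eqP/mdeg1P[i /eqP ->] := dhomog_mf l1 ml.
by rewrite -!mevalX !mevalXU !mxE mulrDr mulrCA.
Qed.

Lemma homog1_eval0 (F : fieldType) (n : nat) (l : {mpoly F[n.+1]}) :
  l \is 1.-homog -> peval l 0 = 0.
Proof.
by move=> /(homog1_linear (-1) 0 0); rewrite scaler0 addr0 mulN1r subrr.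
Qed.

Lemma peval_prod (F : fieldType) (n : nat) (I : finType) (P : pred I)
    (G : I -> {mpoly F[n.+1]}) (v : 'rV[F]_n.+1) :
  peval (\prod_(i | P i) G i) v = \prod_(i | P i) peval (G i) v.
Proof. exact: rmorph_prod. Qed.

(** A complement of [U] is a line spanned by some [u]. The form reads off, at a coordinate where [u]
    is nonzero, the component of [v] along that line. *)
Lemma hyperplane_form (F : fieldType) (n : nat) (U : {vspace 'rV[F]_n.+1}) :
  \dim U = n ->
  exists l : {mpoly F[n.+1]},
    l \is 1.-homog /\ forall v, v \in U <-> peval l v = 0.
Proof.
move=> Un; have C1 : \dim U^C = 1%N.
  by rewrite dimv_compl dimvf /dim /= mul1n Un subSnn.
pose u := vpick U^C; have u0 : u != 0 by rewrite vpick0 -dimv_eq0 C1.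
have Cu : (U^C)%VS = <[u]>%VS.
  by apply/esym/eqP; rewrite eqEdim C1 dim_vline u0 -memvE memv_pick.
have [c uc] : exists c, u 0 c != 0.
  apply/existsP; apply: contraNT u0; rewrite negb_exists => /forallP uc.
  by apply/eqP/rowP => c; rewrite mxE; apply/eqP/negPn/uc.
pose g v := v - projv U v.
exists (\sum_k g (delta_mx 0 k) 0 c *: 'X_k); split.
  by apply: rpred_sum => k _; apply: rpredZ; rewrite dhomogX; apply/eqP/mdeg1.
have gE v : peval (\sum_k g (delta_mx 0 k) 0 c *: 'X_k) v = g v 0 c.
  rewrite /peval raddf_sum /= /g {2 3}[v]row_sum_delta linear_sum /=.
  rewrite -sumrB summxE; apply: eq_bigr => k _.
  by rewrite mevalZ mevalXU linearZ /= -scalerBr [RHS]mxE mulrC.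
move=> v; rewrite gE; split=> [vU|gv0].
  by rewrite /g projv_id ?subrr ?mxE.
have : g v \in (U^C)%VS by apply: memv_projC.
rewrite Cu => /vlineP[a ga]; move: gv0; rewrite ga mxE => /eqP.
rewrite mulf_eq0 (negPf uc) orbF => /eqP a0.
move: ga; rewrite a0 scale0r /g => /eqP; rewrite subr_eq0 => /eqP ->.
exact: memv_proj.
Qed.

(** The integers below [size p] are distinct in characteristic zero, and too many to be all
    roots. *)
Lemma char0_nonroot (F : fieldType) (p : {poly F}) :
  [pchar F] =i pred0 -> p != 0 -> exists t, ~~ root p t.
Proof.
move=> /pcharf0P F0 p0; pose s : seq F := [seq i%:R | i <- iota 0 (size p)].
have us : uniq s.
  rewrite map_inj_in_uniq ?iota_uniq // => i j _ _.
  wlog ij : i j / (i <= j)%N => [W e|e].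
    by case: (leqP i j) => [/W|/ltnW/W/(_ (esym e))]; [apply|].
  apply/eqP; rewrite eqn_leq ij /= -subn_eq0 -F0 natrB ?e ?subrr //.
have : ~~ all (root p) s.
  apply/negP => /(max_poly_roots p0)/(_ us).
  by rewrite size_map size_iota ltnn.
by case/allPn => t _ ?; exists t.
Qed.

(** Each hyperplane lowers the dimension by at most one. *)
Lemma dim_bigcap_hyperplanes (F : fieldType) (n : nat) (I : finType)
    (P : pred I) (U : I -> {vspace 'rV[F]_n.+1}) :
  (forall i, \dim (U i) = n) ->
  (n < \dim (\bigcap_(i | P i) U i) + \sum_(i | P i) 1)%N.
Proof.
move=> Un; apply: (big_rec2 (fun V k => n < \dim (V : {vspace _}) + k)%N).
  by rewrite dimvf /dim /= mul1n addn0.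
move=> i V k _ VP; have := dimv_sum_cap (U i) V.
have : (\dim (U i + V) <= n.+1)%N.
  by rewrite (leq_trans (dimvS (subvf _))) // dimvf /dim /= mul1n.
rewrite Un; lia.
Qed.

(** * Nodes of a cage and its coordinate lines *)

Section Cage.

Variables (F : fieldType) (n d : nat) (K : cage F n d).
Variable L : 'I_n -> 'I_d -> {mpoly F[n.+1]}.
Hypothesis KL : defining_forms K L.

Lemma in_nodeP (I : {ffun 'I_n -> 'I_d}) (v : 'rV[F]_n.+1) :
  v \in sval (node K I) <-> forall j, peval (L j (I j)) v = 0.
Proof.
rewrite /= memvE; split=> [/subv_bigcapP vI j|vI].
  by apply/(KL j (I j)).2; rewrite memvE vI.
by apply/subv_bigcapP => j _; rewrite -memvE; apply/(KL j (I j)).2.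
Qed.

(** Otherwise [v] would span a second node, with [i] in place of [I j], against the distinctness of
    the nodes. *)
Lemma node_off_hyperplane (I : {ffun 'I_n -> 'I_d}) (v : 'rV[F]_n.+1)
    (j : 'I_n) (i : 'I_d) :
  v \in sval (node K I) -> v != 0 -> i != I j -> peval (L j i) v != 0.
Proof.
move=> vI v0; apply: contraNneq => Lv.
pose I' := [ffun j' => if j' == j then i else I j'].
have vline J : v \in sval (node K J) -> <[v]>%VS = sval (node K J).
  move=> vJ; apply/eqP; rewrite eqEdim -memvE vJ dim_vline v0.
  by rewrite (eqP (valP (node K J))).
have : I' = I.
  apply: (@cage_distinct _ _ _ K).
  rewrite -[LHS](vline I') ?(vline I) //; apply/in_nodeP => j'.
  by rewrite ffunE; case: eqP => [->//|_]; move/in_nodeP: vI; apply.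
by move/ffunP/(_ j); rewrite ffunE eqxx => ->.
Qed.

Lemma node_vector (I : {ffun 'I_n -> 'I_d}) :
  exists2 v, v \in sval (node K I) & v != 0.
Proof.
exists (vpick (sval (node K I))); first exact: memv_pick.
by rewrite vpick0 -dimv_eq0 (eqP (valP (node K I))).
Qed.

(** Move from the node [v] in a second direction [w] of the line: each form of color [j] becomes a
    nonzero polynomial in the parameter, and some value avoids all their roots. *)
Lemma generic_point_on_line (I : {ffun 'I_n -> 'I_d}) (j : 'I_n) :
  [pchar F] =i pred0 ->
  exists v, (forall j', j' != j -> peval (L j' (I j')) v = 0) /\
    forall i, peval (L j i) v != 0.
Proof.
move=> F0; have [v vI v0] := node_vector I.
pose W := (\bigcap_(j' | j' != j) hyp K j' (I j'))%VS.
(* [W] has dimension at least 2, being cut out by n - 1 hyperplanes, but meets the hyperplane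
   [hyp K j (I j)] in dimension 1. *)
have /subvPn[w wW wI] : ~~ (W <= hyp K j (I j))%VS.
  have := dim_bigcap_hyperplanes (fun j' => j' != j)
    (fun j' => hyp_dim K j' (I j')).
  have : (\sum_(j' < n | j' != j) 1).+1 = n.
    by rewrite -[RHS]card_ord -sum1_card [RHS](bigD1 j).
  have := cage_transversal K I; rewrite (bigD1 j) //= -/W => /eqP cap1 s dW.
  by apply/negP => /capv_idPr WH; move: dW; rewrite -/W -WH cap1 add1n s ltnn.
have L1 j' i : L j' i \is 1.-homog by have [] := KL j' i.
have wj' j' : j' != j -> peval (L j' (I j')) w = 0.
  by move=> jj'; apply/(KL j' (I j')).2; move: wW; rewrite memvE =>
    /subv_bigcapP/(_ j' jj'); rewrite memvE.
have wj : peval (L j (I j)) w != 0.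
  by apply: contraNneq wI => /(KL j (I j)).2.
pose P := \prod_i ((peval (L j i) v)%:P + (peval (L j i) w) *: 'X).
have [|t] := @char0_nonroot _ P F0.
  (* The factor for [I j] has nonzero slope, by the choice of [w]; the others have nonzero constant
     term, since [v] is off their hyperplanes. *)
  apply/prodf_neq0 => i _; apply/eqP => /polyP Pi.
  have := Pi 0%N; rewrite coefD coefC coefZ coefX coef0 /= mulr0 addr0 => Lv.
  have := Pi 1%N; rewrite coefD coefC coefZ coefX coef0 /= mulr1 add0r => Lw.
  have [ii|ii] := eqVneq i (I j); first by rewrite -ii Lw eqxx in wj.
  by have := node_off_hyperplane vI v0 ii; rewrite Lv eqxx.
rewrite /root horner_prod => /prodf_neq0 Pt.
exists (v + t *: w); split=> [j' jj'|i].
  by rewrite homog1_linear // wj' // mulr0 addr0; move/in_nodeP: vI; apply.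
by have := Pt i isT; rewrite !hornerE homog1_linear // [t * _]mulrC.
Qed.

End Cage.

(** Reduces arbitrary orderings of the hyperplanes to the given one. *)
Lemma permute_cage (F : fieldType) (n d : nat) (K : cage F n d)
    (s : 'I_n -> 'S_d) :
  exists K' : cage F n d, forall j i, hyp K' j i = hyp K j (s j i).
Proof.
pose sI (I : {ffun 'I_n -> 'I_d}) := [ffun j => s j (I j)].
have capE (I : {ffun 'I_n -> 'I_d}) :
    (\bigcap_(j < n) hyp K j (s j (I j)) = sval (node K (sI I)))%VS.
  by apply: eq_bigr => j _; rewrite ffunE.
have trK (I : {ffun 'I_n -> 'I_d}) :
    \dim (\bigcap_(j < n) hyp K j (s j (I j)))%VS == 1%N.
  by rewrite capE; apply: (valP (node K _)).
have injK : injective (fun I : {ffun 'I_n -> 'I_d} =>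
    (\bigcap_(j < n) hyp K j (s j (I j)))%VS).
  move=> I J; rewrite !capE => /(@cage_distinct _ _ _ K)/ffunP IJ.
  by apply/ffunP => j; have := IJ j; rewrite !ffunE => /perm_inj.
by exists (Cage (fun j i => hyp_dim K j (s j i)) trK injK).
Qed.

Lemma cage_poly_vanishes (F : fieldType) (n d : nat) (K : cage F n d)
    (L : 'I_n -> 'I_d -> {mpoly F[n.+1]}) (lam : 'rV[F]_n)
    (I : {ffun 'I_n -> 'I_d}) :
  defining_forms K L -> vanishes_at (cage_poly L lam) (node K I).
Proof.
move=> KL v /(in_nodeP KL) vI; rewrite /cage_poly /peval raddf_sum.
rewrite big1 // => j _; rewrite /= mevalZ -/(peval _ v) peval_prod (bigD1 (I j)) //= vI.
by rewrite mul0r mulr0.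
Qed.

(** * The Newton basis attached to a cage *)

Section NewtonBasis.

Variables (F : fieldType) (n d k : nat) (K : cage F n d).
Variable L : 'I_n -> 'I_d -> {mpoly F[n.+1]}.
Hypotheses (F0 : [pchar F] =i pred0) (KL : defining_forms K L).
Hypothesis kd : (k <= d)%N.

(** Only the exponents of X_1, ..., X_n select hyperplanes; that of X_0 makes up the degree. *)
Let ex (x : monomials n k) (j : 'I_n) : nat := monomial x (lift ord0 j).

Let ex_deg (x : monomials n k) :
  (monomial x ord0 + \sum_(j < n) ex x j)%N = k.
Proof. by rewrite -[RHS](monomial_deg x) mdegE big_ord_recl. Qed.

Let ex_le (x : monomials n k) (j : 'I_n) : (ex x j <= k)%N.
Proof.
rewrite -[leqRHS](ex_deg x) (bigD1 j) //= addnCA; exact: leq_addr.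
Qed.

Let interior (x : monomials n k) : bool := [forall j, (ex x j < d)%N].

(** An exponent at least [d] uses up the whole degree [k <= d], so [x] is the pure power X_j^d. *)
Let cornerP (x : monomials n k) : ~~ interior x ->
  exists j, [/\ ex x j = d, k = d, monomial x ord0 = 0%N
    & forall j', j' != j -> ex x j' = 0%N].
Proof.
rewrite negb_forall => /existsP[j]; rewrite -leqNgt => dj; exists j.
have := ex_deg x; rewrite (bigD1 j) //=.
set s := (\sum_(_ < n | _) _)%N => e.
have s0 : s = 0%N by have := ex_le x j; lia.
split; [have := ex_le x j; lia | have := ex_le x j; lia | lia |].
move=> j' jj'; move/eqP: s0; rewrite sum_nat_eq0.
by move=> /forall_inP/(_ _ jj')/eqP.
Qed.

Lemma newton_point (x : monomials n k) :
  exists v : 'rV[F]_n.+1, [/\ v != 0,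
    forall j (i : 'I_d), i = ex x j :> nat -> peval (L j i) v = 0,
    forall j (i : 'I_d), (i < ex x j)%N -> peval (L j i) v != 0
    & interior x -> exists2 I : {ffun 'I_n -> 'I_d},
        forall j, I j = ex x j :> nat & v \in sval (node K I)].
Proof.
have [/forallP xd|/cornerP[j [xj dk _ xj']]] := boolP (interior x).
  pose I := [ffun j => Ordinal (xd j)].
  have [v vI v0] := node_vector K I.
  exists v; split=> // [j i ij|j i ij|_].
  - have -> : i = I j by apply: val_inj; rewrite ffunE.
    exact: (in_nodeP KL I v).1.
  - apply: (node_off_hyperplane KL vI v0).
    by apply: contraTneq ij => ->; rewrite ffunE /= ltnn.
  - by exists I => // j; rewrite ffunE.
(* With [d = 0] there are no hyperplanes to meet or avoid, and any nonzero vector will do. *)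
have [d0|d0] := posnP d.
  exists (const_mx 1); split=> // [|? []|? []]; last first.
  - by move=> m md; exfalso; rewrite d0 in md.
  - by move=> m md; exfalso; rewrite d0 in md.
  - apply/eqP => /rowP/(_ 0); rewrite !mxE; exact/eqP/oner_neq0.
have [v [vj' vj]] := generic_point_on_line KL [ffun=> Ordinal d0] j F0.
exists v; split=> // [|j' i ij|j' i ij].
- apply: contraTneq (vj (Ordinal d0)) => ->.
  by rewrite homog1_eval0 ?eqxx //; case: (KL j (Ordinal d0)).
- have [jj|jj] := eqVneq j' j.
    by have := ltn_ord i; rewrite ij jj xj ltnn.
  have := vj' _ jj; rewrite ffunE; congr (peval (L _ _) _ = 0).
  by apply: val_inj; rewrite /= ij xj'.
- have [->//|jj] := eqVneq j' j; by move: ij; rewrite xj'.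
Qed.

(** The multi-indices with 0-based sum at most [k] are exactly the exponents of the interior
    monomials. *)
Lemma cage_poly_of_vanishing (f : {mpoly F[n.+1]}) :
  f \is k.-homog ->
  (forall I : {ffun 'I_n -> 'I_d}, (\sum_j I j <= k)%N ->
    vanishes_at f (node K I)) ->
  (exists lam, f = cage_poly L lam) /\ ((k < d)%N -> f = 0).
Proof.
move=> fk fI.
have /fin_all_exists[p pP] := newton_point.
have /fin_all_exists[c pc] : forall x, exists c, p x 0 c != 0.
  move=> x; have [p0 _ _ _] := pP x.
  apply/existsP; apply: contraNT p0; rewrite negb_exists => /forallP pc.
  by apply/eqP/rowP => c; rewrite mxE; apply/eqP/negPn/pc.
pose Q x := 'X_(c x) ^+ monomial x ord0 *
  \prod_(j < n) \prod_(i < d | (i < ex x j)%N) L j i.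
have Qk x : Q x \is k.-homog.
  rewrite -(ex_deg x); apply: dhomogM.
    rewrite -[X in X.-homog]mul1n; apply: dhomogMn.
    by rewrite dhomogX; apply/eqP/mdeg1.
  apply: homog_bigprod => j _.
  rewrite [X in X.-homog](_ : _ = \sum_(i < d | (i < ex x j)%N) 1)%N;
    last first.
    rewrite big_ord_narrow ?(leq_trans (ex_le x j)) //.
    by rewrite sum1_card card_ord.
  by apply: homog_bigprod => i _; have [] := KL j i.
(* If [ex y j < ex x j], then [Q x] contains the factor of color [j] and index [ex y j], which
   vanishes at [p y]. *)
have Qle x y : peval (Q x) (p y) != 0 -> forall j, (ex x j <= ex y j)%N.
  move=> Qxy j; rewrite leqNgt; apply: contraNN Qxy => yx.
  have yd : (ex y j < d)%N by rewrite (leq_trans yx) // (leq_trans (ex_le x j)).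
  have [_ py _ _] := pP y.
  rewrite /peval mevalM -/(peval (\prod_(_ < _) _) _) peval_prod (bigD1 j) //=.
  by rewrite peval_prod (bigD1 (Ordinal yd)) //= py // !mul0r mulr0.
have [||||a fE] := @newton_expansion F n k Q p (fun x => \sum_j ex x j)%N
  interior f Qk _ _ _ fk.
- move=> x; have [_ _ px _] := pP x.
  rewrite /peval mevalM -/(peval (\prod_(_ < _) _) _) peval_prod mulf_neq0 //.
    by rewrite rmorphXn /= mevalXU expf_neq0.
  by apply/prodf_neq0 => j _; rewrite peval_prod; apply/prodf_neq0 => i /px.
- move=> x y xy /Qle le; rewrite ltn_neqAle leq_sum ?andbT //.
  (* Equal sums of termwise ordered exponents force equal exponents, and the fixed degree then gives
     that of X_0. *)
  apply: contraNneq xy => e; apply/eqP/monomial_inj/mnmP => i.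
  have xyj j : ex x j = ex y j.
    have /leqif_sum[_] : forall j : 'I_n, true ->
      (ex x j <= ex y j ?= iff (ex x j == ex y j))%N by move=> *; split.
    by rewrite e eqxx => /esym/forall_inP/(_ j isT)/eqP.
  have [j ->|->] := unliftP ord0 i; first exact: xyj.
  by apply: (@addIn (\sum_j ex x j)%N); rewrite ex_deg e ex_deg.
- move=> x y /forallP yd /Qle xy; apply/forallP => j.
  exact: leq_ltn_trans (xy j) (yd j).
- move=> x xi; have [_ _ _ /(_ xi)[I Ix pI]] := pP x; apply: (fI I) pI.
  rewrite (eq_bigr (ex x)) // -[leqRHS](ex_deg x); exact: leq_addl.
split; last first.
  move=> kltd; rewrite fE big1 // => x /cornerP[j [_ dk _ _]].
  by rewrite dk ltnn in kltd.
rewrite fE; apply: (big_ind (fun g => exists lam, g = cage_poly L lam)).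
- by exists 0; rewrite /cage_poly big1 // => j _; rewrite mxE scale0r.
- move=> _ _ [l1 ->] [l2 ->]; exists (l1 + l2).
  by rewrite /cage_poly -big_split; apply: eq_bigr => j _; rewrite mxE scalerDl.
(* For x = X_j^d, [Q x] is the full product of color [j], so its term is the cage polynomial of a
   multiple of the [j]-th unit vector. *)
move=> x /cornerP[j [xj _ x0 xj']]; exists (a x *: delta_mx 0 j).
have -> : Q x = \prod_(i < d) L j i.
  rewrite /Q x0 expr0 mul1r (bigD1 j) //= [X in _ * X]big1 ?mulr1.
    by apply: eq_bigl => i; rewrite xj ltn_ord.
  by move=> j' jj'; rewrite xj' // big_pred0.
rewrite /cage_poly (bigD1 j) //= !mxE !eqxx mulr1.
rewrite [X in _ + X]big1 ?addr0 // => j' jj'.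
by rewrite !mxE (negPf jj') andbF mulr0 scale0r.
Qed.

End NewtonBasis.

(** * Equations through supra-simplicial and simplicial sets *)

Lemma defining_forms_exist (F : fieldType) (n d : nat) (K : cage F n d) :
  exists L, defining_forms K L.
Proof.
have /fin_all_exists[L LP] : forall j, exists Lj : 'I_d -> {mpoly F[n.+1]},
    forall i, Lj i \is 1.-homog /\
      forall v, v \in hyp K j i <-> peval (Lj i) v = 0.
  move=> j.
  have /fin_all_exists[Lj LjP] := fun i => hyperplane_form (hyp_dim K j i).
  by exists Lj.
by exists L.
Qed.

(** Serves both claims: [e = d] for a supra-simplicial set, and [e = d.+1] for a simplicial one,
    whose bound is also [d + n]. *)
Lemma equation_through_nodes (F : fieldType) (n d e k : nat) (K : cage F n e)
    (L : 'I_n -> 'I_e -> {mpoly F[n.+1]}) (s : 'I_n -> 'S_e)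
    (f : {mpoly F[n.+1]}) :
  [pchar F] =i pred0 -> defining_forms K L -> (d <= e)%N -> (k <= d)%N ->
  f \is k.-homog -> nodes_upto K s (d + n)%N `<=` zero_locus [:: f] ->
  (exists lam, f = cage_poly L lam) /\ ((k < e)%N -> f = 0).
Proof.
move=> F0 KL de kd fk fV; have [K' hK'] := permute_cage K s.
have KL' : defining_forms K' (fun j i => L j (s j i)).
  by move=> j i; rewrite hK'; apply: KL.
have [|[lam fE] f0] :=
    cage_poly_of_vanishing F0 KL' (leq_trans kd de) fk; last first.
  split=> //; exists lam; rewrite fE; apply: eq_bigr => j _; congr (_ *: _).
  by rewrite [RHS](reindex_inj (@perm_inj _ (s j))).
move=> I Ik v vI; pose J := [ffun j => s j (I j)].
apply: (fV (node K J) _ f (mem_head _ _)); last first.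
  apply/(in_nodeP KL) => j; rewrite ffunE.
  exact: (in_nodeP KL' I v).1.
(* The 1-based norm exceeds the 0-based sum by [n], so a sum at most [k <= d] gives a norm at most
   [d + n]. *)
exists I => //=; rewrite /mnorm (eq_bigr (fun j => I j + 1)%N); last first.
  by move=> j _; rewrite addn1.
by rewrite big_split sum1_card card_ord leq_add2r (leq_trans Ik).
Qed.

Theorem theorem2p1 (R : realType) (A : fieldType)
    (hA : A = (R : fieldType) \/ A = (R[i]%C : fieldType)) (n d : nat) :
  (forall (V : set (proj A n)) (K : cage A n d) (S : set (proj A n)),
      given_in_degrees_le d V -> supra_simplicial K S -> S `<=` V ->
      (forall I : {ffun 'I_n -> 'I_d}, V (node K I)) /\
      (forall L : 'I_n -> 'I_d -> {mpoly A[n.+1]}, defining_forms K L ->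
        exists lams : seq 'rV[A]_n,
          [/\ lams != [::],
              forall lam, lam \in lams -> lam != 0
            & V = zero_locus [seq cage_poly L lam | lam <- lams]]))
  /\
  (forall (V : set (proj A n)) (K : cage A n d.+1) (T : set (proj A n)),
      given_in_degrees_le d V -> simplicial K T -> ~ (T `<=` V)).
Proof.
have F0 : [pchar A] =i pred0.
  by case: hA => ->; apply: Num.Theory.pchar_num.
split=> [V K S [fs [fs0 fsP VE]] [s SE] SV | V K T [fs [fs0 fsP VE]] [s TE] TV].
  (* Each single equation of [V] is already a cage polynomial; its vector is nonzero because the
     equation is. *)
  have fsE L : defining_forms K L -> forall f, f \in fs ->
      exists2 lam, lam != 0 & f = cage_poly L lam.
    move=> KL f ffs; have [fn0 [k kd fk]] := fsP f ffs.
    have [|[lam fE] _] :=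
        equation_through_nodes (s := s) F0 KL (leqnn d) kd fk.
      move=> x; rewrite -SE => /SV; rewrite VE => Vx _ /[!inE] /eqP ->.
      exact: Vx.
    exists lam => //; apply: contraNneq fn0 => lam0; rewrite fE lam0.
    by rewrite /cage_poly big1 // => j _; rewrite mxE scale0r.
  split=> [I|L KL].
    have [L KL] := defining_forms_exist K.
    by rewrite VE => f /(fsE L KL)[lam _ ->]; apply: cage_poly_vanishes.
  have [lams [lams0 fsl]] : exists lams : seq 'rV[A]_n,
      (forall lam, lam \in lams -> lam != 0) /\
      fs = [seq cage_poly L lam | lam <- lams].
    have := fsE L KL; elim: (fs) => [_|f gs IH fgs]; first by exists [::].
    have [lam lam0 ->] := fgs f (mem_head _ _).
    have [|lams [lams0 ->]] := IH.
      by move=> g ggs; apply: fgs; rewrite inE ggs orbT.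
    exists (lam :: lams); split=> // l; rewrite inE => /orP[/eqP->//|].
    exact: lams0.
  exists lams; split=> //; last by rewrite VE fsl.
  by apply: contraNneq fs0 => l0; rewrite fsl l0.
have [L KL] := defining_forms_exist K.
(* One equation suffices: its degree is below [d.+1], so it would have to be zero. *)
case: fs fs0 fsP VE => // f fs _ /(_ f (mem_head _ _))[fn0 [k kd fk]] VE.
have [|_ f0] := equation_through_nodes (s := s) F0 KL (leqnSn d) kd fk.
  move=> x; have -> : (d + n = d.+1 + n - 1)%N by rewrite addSn subn1.
  rewrite -TE => /TV; rewrite VE => Vx _ /[!inE] /eqP ->.
  exact: Vx (mem_head _ _).
by rewrite f0 ?ltnS ?eqxx in fn0.
Qed.
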